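(* Let $N$ be a finite set. Let $u_1,u_2,v_1,\dots,v_m$ ($m\ge1$) be distinct elementary imsets over $N$ and let $\alpha_1,\alpha_2,\beta_1,\dots,\beta_m$ be positive integers with $$\alpha_1u_1+\alpha_2u_2=\beta_1v_1+\dots+\beta_mv_m .$$ Then $m=2$, $\alpha_1=\alpha_2=\beta_1=\beta_2$, and (up to the order of the terms on each side) the relation is a positive multiple of $$u_{\langle a,b_1|C\rangle}+u_{\langle a,b_2|b_1C\rangle}=u_{\langle a,b_2|C\rangle}+u_{\langle a,b_1|b_2C\rangle}$$ for some distinct $a,b_1,b_2\in N$ and some $C\subseteq N\setminus\{a,b_1,b_2\}$.
   Context: Unions of sets are written by juxtaposition and singletons $\{i\}$ as $i$. Functions on the power set $\mathcal{P}(N)$ are identified with vectors in $\mathbb{R}^{2^{|N|}}$; $\delta_A(S)=1$ if $S=A$ and $0$ otherwise. For distinct $a,b\in N$ and $C\subseteq N\setminus\{a,b\}$ the elementary imset over $N$ is $u_{\langle a,b|C\rangle}=\delta_{abC}+\delta_C-\delta_{aC}-\delta_{bC}$ (so $u_{\langle a,b|C\rangle}=u_{\langle b,a|C\rangle}$). *)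

(* Defs.v *)
From HB Require Import structures.
From mathcomp Require Import all_boot all_order all_algebra.
From mathcomp Require Import reals.

Set Implicit Arguments.
Unset Strict Implicit.
Unset Printing Implicit Defensive.

Import GRing.Theory Num.Theory.
Local Open Scope ring_scope.

Section ElementaryImsets.
Variables (R : realType) (N : finType).

Definition delta (A : {set N}) : {ffun {set N} -> R} :=
  [ffun S => (S == A)%:R].

(* Total in a, b, C; it is an elementary imset only when a, b are distinct and
   lie outside C, which [is_elementary_imset] requires. *)
Definition eimset (a b : N) (C : {set N}) : {ffun {set N} -> R} :=
  delta (a |: (b |: C)) + delta C - delta (a |: C) - delta (b |: C).

Definition is_elementary_imset (u : {ffun {set N} -> R}) : Prop :=
  exists (a b : N) (C : {set N}),
    [/\ a != b, a \notin C, b \notin C & u = eimset a b C].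

End ElementaryImsets.

Arguments delta {R N} A.
Arguments eimset {R N} a b C.
Arguments is_elementary_imset {R N} u.

(* Main.v *)
(** Pair the relation with three families of functions on the power set for
which every elementary imset takes the value 0 or 1: S |-> [T \subset S], S
|-> [S \subset T] and S |-> max(0, |S| - k - 1). Each gives an identity
between nonnegative combinations of truth values, so a function that is
positive on some v_j is positive on u_1 or u_2, and conversely. Write u_i as a
pair e_i and a base C_i. If |C_1| = |C_2| these constraints force every v_j to
be u_1 or u_2. If |C_1| < |C_2| they force the right-hand terms to be the pair
e_2 over C_1, and the pair e_1 over (e_2 C_2) \ e_1; testing T = e_1 C_1, then
T = e_2 C_2 minus a point of e_2, then T = C_2, gives equal coefficients and
the shape of the square. *)

Require Import Defs.
From HB Require Import structures.
From mathcomp Require Import all_boot all_order all_algebra.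
From mathcomp Require Import reals.
From mathcomp Require Import zify ring.

Set Implicit Arguments.
Unset Strict Implicit.
Unset Printing Implicit Defensive.

Import GRing.Theory Num.Theory.

(** * Identities between nonnegative combinations of truth values *)

Section Balance.
Variables (m : nat) (a1 a2 : nat) (b : 'I_m -> nat) (p1 p2 : bool).
Variable p : 'I_m -> bool.
Hypothesis bal : a1 * p1 + a2 * p2 = \sum_(i < m) b i * p i.

(** A true [p i] of positive weight makes the right side positive, which is impossible when [p1] and
    [p2] are both false. *)
Lemma balance_or i : 0 < b i -> p i -> p1 || p2.
Proof.
move=> bi pi; move: bal; rewrite (bigD1 i) //= pi muln1.
by case: p1; case: p2; lia.
Qed.

(** If every [p i] were false, the right side would vanish, while the left side is at least [a1] or
    [a2]. *)
Lemma balance_ex : 0 < a1 -> 0 < a2 -> p1 || p2 -> exists i, p i.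
Proof.
move=> a1_gt0 a2_gt0 p12; apply/existsP; apply: contraPT bal.
rewrite negb_exists => /forallP np; rewrite big1 => [|i _].
  by case: p1 p2 p12 => [] []; lia.
by rewrite (negPf (np i)) muln0.
Qed.

End Balance.

(** * Disjoint unions and two-element sets *)

Lemma setUDK (T : finType) (e C : {set T}) :
  [disjoint e & C] -> (e :|: C) :\: e = C.
Proof.
move=> dis; rewrite setDUl setDv set0U; apply/setDidPl.
by rewrite disjoint_sym.
Qed.

Lemma disjointUr_inj (T : finType) (e e' C : {set T}) :
  [disjoint e & C] -> [disjoint e' & C] -> e :|: C = e' :|: C -> e = e'.
Proof.
rewrite !(disjoint_sym _ (mem C)) => dis dis' eU.
by rewrite -(setUDK dis) setUC eU setUC setUDK.
Qed.

Lemma cardU_disjoint (T : finType) (e C : {set T}) :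
  [disjoint e & C] -> #|e :|: C| = #|e| + #|C|.
Proof. by move=> d; rewrite cardsU disjoint_setI0 // cards0 subn0. Qed.

Lemma cards2_other (T : finType) (e : {set T}) (x : T) :
  #|e| = 2 -> x \in e -> exists2 y, y != x & e = [set x; y].
Proof.
move=> card_e xe; have: #|e :\ x| == 1.
  by move: card_e; rewrite (cardsD1 x) xe add1n => -[->].
case/cards1P=> y ey; exists y; last by rewrite -(setD1K xe) ey.
by move: (set11 y); rewrite -ey !inE => /andP[].
Qed.

(** * Consequences of the three families of identities, in terms of pairs and bases alone *)

Section Combinatorics.
Variables (N : finType) (m : nat) (e1 C1 e2 C2 : {set N}).
Variables (E D : 'I_m -> {set N}) (a1 a2 : nat) (b : 'I_m -> nat).
Hypotheses (a1_gt0 : 0 < a1) (a2_gt0 : 0 < a2) (b_gt0 : forall i, 0 < b i).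
Hypotheses (card_e1 : #|e1| = 2) (card_e2 : #|e2| = 2).
Hypothesis card_E : forall i, #|E i| = 2.
Hypotheses (dis1 : [disjoint e1 & C1]) (dis2 : [disjoint e2 & C2]).
Hypothesis disE : forall i, [disjoint E i & D i].
Hypothesis ne1 : forall i, E i = e1 -> D i <> C1.
Hypothesis ne2 : forall i, E i = e2 -> D i <> C2.
Hypothesis supset_balance : forall T : {set N},
  a1 * ((e1 \subset T) && (T \subset e1 :|: C1))
  + a2 * ((e2 \subset T) && (T \subset e2 :|: C2))
  = \sum_(i < m) b i * ((E i \subset T) && (T \subset E i :|: D i)).
Hypothesis subset_balance : forall T : {set N},
  a1 * ((C1 \subset T) && [disjoint e1 & T])
  + a2 * ((C2 \subset T) && [disjoint e2 & T])
  = \sum_(i < m) b i * ((D i \subset T) && [disjoint E i & T]).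
Hypothesis card_balance : forall k : nat,
  a1 * (#|C1| == k) + a2 * (#|C2| == k) = \sum_(i < m) b i * (#|D i| == k).

Let card_A1 : #|e1 :|: C1| = #|C1|.+2.
Proof. by rewrite cardU_disjoint // card_e1. Qed.
Let card_A2 : #|e2 :|: C2| = #|C2|.+2.
Proof. by rewrite cardU_disjoint // card_e2. Qed.
Let card_A i : #|E i :|: D i| = #|D i|.+2.
Proof. by rewrite cardU_disjoint // card_E. Qed.

(** The test set [T = E i] counts the term [i], so [e1] or [e2] lies inside [E i]; equal sizes turn
    the inclusion into an equality. *)
Lemma balance_pair i : E i = e1 \/ E i = e2.
Proof.
have /orP[] := balance_or (supset_balance (E i)) (b_gt0 i)
    (introT andP (conj (subxx _) (subsetUl _ _))) => /andP[sub _]; [left|right];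
  by apply/esym/eqP; rewrite eqEcard sub card_E ?card_e1 ?card_e2.
Qed.

(** Here [T] is the largest test set of [supset_balance] that counts the term [i]. *)
Lemma balance_top i :
  (E i :|: D i \subset e1 :|: C1) \/
  (E i :|: D i \subset e2 :|: C2).
Proof.
have /orP[] := balance_or (supset_balance (E i :|: D i)) (b_gt0 i)
    (introT andP (conj (subsetUl _ _) (subxx _))) => /andP[_ sub];
  by [left | right].
Qed.

(** Here [T] is the smallest test set of [subset_balance] that counts the term [i]. *)
Lemma balance_bottom i : (C1 \subset D i) \/ (C2 \subset D i).
Proof.
have /orP[] := balance_or (subset_balance (D i)) (b_gt0 i)
    (introT andP (conj (subxx _) (disE i))) => /andP[sub _];
  by [left | right].
Qed.

Lemma balance_level i : #|D i| = #|C1| \/ #|D i| = #|C2|.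
Proof.
have /orP[] := balance_or (card_balance #|D i|) (b_gt0 i) (eqxx _) => /eqP;
  by [left | right].
Qed.

(** Equal sizes turn the inclusions between bases and between tops into equalities. A term with top
    [e1 :|: C1] cannot have pair [e1], or it would be [u_1]; so its pair is [e2], and its base is
    not [C1], because top and base determine the pair. It is then [u_2], against distinctness. The
    other top is symmetric. *)
Lemma balance_card_neq (i : 'I_m) : #|C1| <> #|C2|.
Proof.
move=> eqC.
have cardD : #|D i| = #|C1| by case: (balance_level i); lia.
have bot : D i = C1 \/ D i = C2.
  case: (balance_bottom i) => s; [left|right];
  by apply/esym/eqP; rewrite eqEcard s; lia.
have top : E i :|: D i = e1 :|: C1 \/ E i :|: D i = e2 :|: C2.
  case: (balance_top i) => s; [left|right];
  by apply/eqP; rewrite eqEcard s ?card_A1 ?card_A2 card_A; lia.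
have top1 : E i :|: D i = e1 :|: C1 -> E i = e2 /\ D i = C2.
  move=> t; have nE : E i <> e1.
    by move=> eE; apply: (ne1 eE); rewrite -(setUDK (disE i)) t eE setUDK.
  split; first by case: (balance_pair i).
  case: bot => // eD; case: nE; 
    apply: (disjointUr_inj (C := C1)) => //.
    by rewrite -eD.
  by rewrite -{1}eD.
have top2 : E i :|: D i = e2 :|: C2 -> E i = e1 /\ D i = C1.
  move=> t; have nE : E i <> e2.
    by move=> eE; apply: (ne2 eE); rewrite -(setUDK (disE i)) t eE setUDK.
  split; first by case: (balance_pair i).
  case: bot => // eD; case: nE; apply: (disjointUr_inj (C := C2)) => //.
    by rewrite -eD.
  by rewrite -{1}eD.
by case: top => [/top1|/top2] [eE eD]; [case: (ne2 eE)|case: (ne1 eE)].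
Qed.

(** * The case of bases of different sizes *)

Hypothesis ltC : #|C1| < #|C2|.
Hypothesis ED_inj : forall i j, E i = E j -> D i = D j -> i = j.

(** [C2] is too large to lie inside [D i], so the base is [C1]; the pair [e1] would then reproduce
    [u_1]. *)
Lemma balance_low i : #|D i| = #|C1| -> E i = e2 /\ D i = C1.
Proof.
move=> cardD; have eD : D i = C1.
  case: (balance_bottom i) => s; last by move: (subset_leq_card s); lia.
  by apply/esym/eqP; rewrite eqEcard s; lia.
by split=> //; case: (balance_pair i) => // /ne1.
Qed.

(** The top of the term is too large for [e1 :|: C1], so it fills [e2 :|: C2]; the pair [e2] would
    then reproduce [u_2]. *)
Lemma balance_high i :
  #|D i| = #|C2| -> E i = e1 /\ e1 :|: D i = e2 :|: C2.
Proof.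
move=> cardD; have t : E i :|: D i = e2 :|: C2.
  case: (balance_top i) => s.
    by move: (subset_leq_card s); rewrite card_A card_A1; lia.
  by apply/eqP; rewrite eqEcard s card_A card_A2; lia.
have eE : E i = e1.
  case: (balance_pair i) => // eE; case: (ne2 eE).
  by rewrite -(setUDK (disE i)) t eE setUDK.
by split=> //; rewrite -t eE.
Qed.

Lemma sum_two (i1 i2 : 'I_m) (F : 'I_m -> nat) :
  i1 != i2 -> (forall i, i = i1 \/ i = i2) -> \sum_(i < m) F i = F i1 + F i2.
Proof.
move=> ne12 all12.
rewrite (bigD1 i1) //= (bigD1 i2) 1?eq_sym //= big1 ?addn0 // => i.
by case: (all12 i) => ->; rewrite eqxx ?andbF.
Qed.

(** Both levels occur on the left, hence on the right, and a level determines pair and base, so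
    [ED_inj] leaves one term on each. Then [card_balance] at each level reads off its
    coefficient. *)
Lemma balance_two_terms : exists i1 i2,
  [/\ E i1 = e2 /\ D i1 = C1, E i2 = e1 /\ e1 :|: D i2 = e2 :|: C2,
      i1 != i2, forall i, i = i1 \/ i = i2 & b i1 = a1 /\ b i2 = a2].
Proof.
have [|i1 /eqP c1] := balance_ex (card_balance #|C1|) a1_gt0 a2_gt0.
  by rewrite eqxx.
have [|i2 /eqP c2] := balance_ex (card_balance #|C2|) a1_gt0 a2_gt0.
  by rewrite eqxx orbT.
have [E1 D1] := balance_low c1; have [E2 D2] := balance_high c2.
have all12 i : i = i1 \/ i = i2.
  case: (balance_level i) => [/balance_low|/balance_high] [eE eD];
    [left|right]; apply: ED_inj; rewrite ?E1 ?E2 ?D1 //.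
  by rewrite -(setUDK (disE i)) -(setUDK (disE i2)) eE E2 eD D2.
have ne12 : i1 != i2 by apply/eqP=> e12; rewrite -e12 in c2; lia.
exists i1, i2; split=> //.
move: (card_balance #|C1|) (card_balance #|C2|).
rewrite !(sum_two _ ne12 all12) c1 c2 !eqxx.
have -> : (#|C1| == #|C2|) = false by lia.
have -> : (#|C2| == #|C1|) = false by lia.
lia.
Qed.

(** The points [z], [y], [x] are the $a$, $b_1$, $b_2$ of the theorem, and [C1] is its $C$. *)
Lemma balance_square : exists y z x i1 i2,
  [/\ [/\ e1 = [set z; y], e2 = [set z; x] & C2 = y |: C1],
      [/\ uniq [:: z; y; x], z \notin C1, y \notin C1 & x \notin C1],
      [/\ E i1 = e2, D i1 = C1, E i2 = e1 & D i2 = x |: C1],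
      i1 != i2 /\ (forall i, i = i1 \/ i = i2)
    & [/\ a1 = a2, b i1 = a1 & b i2 = a1]].
Proof.
have [i1 [i2 [[E1 D1] [E2 D2] ni all12 [b1 b2]]]] := balance_two_terms.
have neq12 : e1 <> e2 by move=> e12; case: (ne1 (i := i1)); rewrite ?E1.
have dis21 : [disjoint e2 & C1] by rewrite -E1 -D1.
have dis12 : [disjoint e1 & D i2] by rewrite -E2.
have cardD2 : #|D i2| = #|C2|.
  by move: card_A2; rewrite -D2 cardU_disjoint // card_e1 => -[].
have supT (T : {set N}) : a1 * ((e1 \subset T) && (T \subset e1 :|: C1))
    + a2 * ((e2 \subset T) && (T \subset e2 :|: C2))
  = a1 * ((e2 \subset T) && (T \subset e2 :|: C1))
    + a2 * ((e1 \subset T) && (T \subset e2 :|: C2)).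
  by rewrite supset_balance (sum_two _ ni all12) E1 D1 E2 D2 b1 b2.
(* At [T = e1 :|: C1] the first term on the right vanishes, since equal sizes would force [e1 = e2].
   What remains is [a1 + a2 * (s && t) = a2 * t], with [s] for [e2 \subset T] and [t] for
   [T \subset e2 :|: C2]; as [a1] is positive, [t] holds and [s] fails. *)
have [a12 A12 e2A1] : [/\ a1 = a2, e1 :|: C1 \subset e2 :|: C2
                         & ~~ (e2 \subset e1 :|: C1)].
  move: (supT (e1 :|: C1)); rewrite subsetUl subxx /=.
  have -> : (e2 \subset e1 :|: C1) && (e1 :|: C1 \subset e2 :|: C1) = false.
    apply/negP=> /andP[_ s]; apply: neq12.
    apply: (disjointUr_inj (C := C1)) => //.
    by apply/eqP; rewrite eqEcard s card_A1 cardU_disjoint // card_e2; lia.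
  by case: (e1 :|: C1 \subset e2 :|: C2); case: (e2 \subset _) => /=;
    rewrite ?muln0 ?muln1 => eqa; split=> //; move: a1_gt0; clear -eqa; lia.
have /subsetPn[x xe2 xA1] := e2A1.
have xA2 : x \in e2 :|: C2 by rewrite inE xe2.
(* Removing [x] discards both terms with pair [e2]. The term [a2] on the right survives, so the
   first term on the left must survive too, which gives the missing inclusion. *)
have A2x : (e2 :|: C2) :\ x = e1 :|: C1.
  apply/eqP; rewrite eqEsubset andbC subsetD1 A12 xA1 /=.
  move: (supT ((e2 :|: C2) :\ x)); rewrite subD1set !subsetD1.
  rewrite xe2 andbF /= (subset_trans (subsetUl _ _) A12) /=.
  rewrite (contra (subsetP (subsetUl e1 C1) x) xA1) /=.
  case: (_ \subset e1 :|: C1) => //=.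
  by rewrite !muln0 muln1 !add0n => a2E; move: a2_gt0; rewrite -a2E.
have A2E : e2 :|: C2 = x |: (e1 :|: C1) by rewrite -A2x setD1K.
have cardC2 : #|C2| = #|C1|.+1.
  by move: card_A2; rewrite A2E cardsU1 xA1 card_A1 => -[<-].
(* At [T = C2] the left side contains [a2]. Without [C1 \subset C2] only the term [i2] could match
   it; then [D i2 = C2] by size, and [e1 = e2]. *)
have C12 : C1 \subset C2.
  move: (subset_balance C2); rewrite (sum_two _ ni all12) E1 D1 E2 b1 b2.
  rewrite subxx dis2 andbT /=; case: (C1 \subset C2) => //=.
  have -> : D i2 \subset C2 = false; last first.
    by rewrite /= !muln0 muln1 !add0n => a2E; move: a2_gt0; rewrite a2E.
  apply/negP=> s; have D2E : D i2 = C2.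
    by apply/eqP; rewrite eqEcard s cardD2 /=.
  rewrite D2E in dis12 D2.
  by apply: neq12; apply: disjointUr_inj dis12 dis2 D2.
have [xe1 xC1] : x \notin e1 /\ x \notin C1.
  by move: xA1; rewrite inE negb_or => /andP.
have [z zx] := cards2_other card_e2 xe2; rewrite setUC => e2E.
have ze2 : z \in e2 by rewrite e2E set21.
have zC1 : z \notin C1 by rewrite (disjointFr dis21 ze2).
(* The top [e2 :|: C2] exceeds [e1 :|: C1] by [x] alone, so the other point of [e2] falls in
   [e1]. *)
have ze1 : z \in e1.
  have : z \in e2 :|: C2 by rewrite inE ze2.
  by rewrite A2E !inE (negPf zx) (negPf zC1) orbF.
have [y yz e1E] := cards2_other card_e1 ze1.
have ye1 : y \in e1 by rewrite e1E set22.
have yx : y != x by apply: contraNneq xe1 => <-.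
have yC1 : y \notin C1 by rewrite (disjointFr dis1 ye1).
have yC2 : y \in C2.
  have : y \in e2 :|: C2 by rewrite A2E !inE ye1 orbT.
  by rewrite e2E !inE (negPf yz) (negPf yx).
have C2E : C2 = y |: C1.
  apply/esym/eqP; rewrite eqEcard subUset sub1set yC2 C12 cardsU1 yC1 cardC2.
  by rewrite leqnn.
have D2E : D i2 = x |: C1.
  rewrite -(setUDK dis12) D2 A2E setUCA setUDK //.
  rewrite -setI_eq0 setIUr setU_eq0 !setI_eq0 dis1.
  by rewrite disjoint_sym disjoints1 xe1.
exists y, z, x, i1, i2; split=> //.
  by split=> //=; rewrite !inE negb_or eq_sym yz zx yx.
by split=> //; rewrite b2.
Qed.

End Combinatorics.

Local Open Scope ring_scope.

(** * Values of the three families of test functions on elementary imsets *)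

Section Pairing.
Variables (R : realType) (N : finType).
Implicit Types (f : {set N} -> R) (u : {ffun {set N} -> R}) (e C T : {set N}).

Definition pairing f u : R := \sum_S f S * u S.

Lemma pairing_zmod_morphism f : zmod_morphism (pairing f).
Proof.
move=> u v; rewrite /pairing -sumrB; apply: eq_bigr => S _.
by rewrite !ffunE mulrBr.
Qed.

(** Additivity allows a whole relation between imsets to be paired term by term. *)
HB.instance Definition _ f :=
  GRing.isZmodMorphism.Build _ _ (pairing f) (pairing_zmod_morphism f).

Lemma pairing_delta f A : pairing f (delta A) = f A.
Proof.
rewrite /pairing (bigD1 A) //= big1 => [|S neSA]; last first.
  by rewrite ffunE (negPf neSA) mulr0.
by rewrite ffunE eqxx mulr1 addr0.
Qed.

Lemma pairing_eimset f a b C :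
  pairing f (eimset a b C) =
  f (a |: (b |: C)) + f C - f (a |: C) - f (b |: C).
Proof. by rewrite /eimset !raddfB raddfD /= !pairing_delta. Qed.

(** Indexing by the set [e] builds in the symmetry in $a$ and $b$, so equality of pairs is equality
    of sets. *)
Definition imset_of e C : {ffun {set N} -> R} :=
  delta (e :|: C) + delta C - \sum_(x in e) delta (x |: C).

Lemma eimsetE a b C : a != b -> eimset a b C = imset_of [set a; b] C.
Proof.
move=> neab; rewrite /imset_of big_setU1 ?inE //= big_set1 -setUA.
by rewrite /eimset opprD addrA.
Qed.

Lemma elementary_imsetP u :
  is_elementary_imset u ->
  exists eC : {set N} * {set N},
    [/\ #|eC.1| = 2%N, [disjoint eC.1 & eC.2] & u = imset_of eC.1 eC.2].
Proof.
case=> a [b] [C] [neab aC bC ->]; exists ([set a; b], C) => /=.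
rewrite cards2 neab eimsetE //; split=> //.
by rewrite disjoints_subset subUset !sub1set !inE aC bC.
Qed.

Lemma pairing_imset_of f a b C : a != b ->
  pairing f (imset_of [set a; b] C) =
  f (a |: (b |: C)) + f C - f (a |: C) - f (b |: C).
Proof. by move=> neab; rewrite -eimsetE // pairing_eimset. Qed.

(** With $X$, $p$, $q$ the truth values of [T \subset a |: (b |: C)], [a \in T], [b \in T], the four
    values combine to $X(1+(1-p)(1-q)-(1-q)-(1-p))=Xpq$. *)
Lemma pairing_supset T e C : #|e| = 2%N -> [disjoint e & C] ->
  pairing (fun S => (T \subset S)%:R) (imset_of e C) =
  ((e \subset T) && (T \subset e :|: C))%:R.
Proof.
move/eqP/cards2P=> [a [b] [neab ->]].
rewrite disjoints_subset subUset !sub1set !inE => /andP[aC bC].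
rewrite pairing_imset_of // subUset !sub1set -setUA.
set X := T \subset a |: (b |: C).
have sub3 : (T \subset C) = [&& X, a \notin T & b \notin T].
  apply/idP/and3P=> [TC|[/subsetP TX aT bT]].
    split; last 2 first.
    - by apply: contra aC; apply: subsetP.
    - by apply: contra bC; apply: subsetP.
    by apply: subset_trans TC _; rewrite setUA subsetUr.
  apply/subsetP=> x xT; move: (TX x xT); rewrite !inE.
  by case/or3P=> // /eqP xE; rewrite xE ?(negPf aT) ?(negPf bT) in xT.
have suba : (T \subset a |: C) = X && (b \notin T).
  apply/idP/andP=> [TC|[/subsetP TX bT]].
    split; first by apply: subset_trans TC _; rewrite setUCA subsetUr.
    apply/negP=> /(subsetP TC); rewrite !inE (negPf bC) orbF.
    by rewrite eq_sym (negPf neab).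
  apply/subsetP=> x xT; move: (TX x xT); rewrite !inE.
  by case/or3P=> [->//|/eqP xE|->]; rewrite ?orbT // -xE xT in bT *.
have subb : (T \subset b |: C) = X && (a \notin T).
  apply/idP/andP=> [TC|[/subsetP TX aT]].
    split; first by apply: subset_trans TC _; rewrite subsetUr.
    apply/negP=> /(subsetP TC); rewrite !inE (negPf aC) orbF.
    by rewrite (negPf neab).
  apply/subsetP=> x xT; move: (TX x xT); rewrite !inE.
  by case/or3P=> [/eqP xE|->//|->]; rewrite ?orbT // -xE xT in aT *.
rewrite sub3 suba subb.
by case: (X); case: (a \in T); case: (b \in T) => /=; ring.
Qed.

Lemma pairing_subset T e C : #|e| = 2%N -> [disjoint e & C] ->
  pairing (fun S => (S \subset T)%:R) (imset_of e C) =
  ((C \subset T) && [disjoint e & T])%:R.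
Proof.
move/eqP/cards2P=> [a [b] [neab ->]] _.
rewrite pairing_imset_of // disjoints_subset !subUset !sub1set !inE.
by case: (C \subset T); case: (a \in T); case: (b \in T) => /=; ring.
Qed.

(** This is a second difference, centred at [#|C|.+1], of a function of the size that is piecewise
    linear with its only kink at [k.+1]. Truncated subtraction on [nat] supplies the maximum with
    0. *)
Lemma pairing_card k e C : #|e| = 2%N -> [disjoint e & C] ->
  pairing (fun S => (#|S| - k.+1)%N%:R) (imset_of e C) = (#|C| == k)%:R.
Proof.
move/eqP/cards2P=> [a [b] [neab ->]].
rewrite disjoints_subset subUset !sub1set !inE => /andP[aC bC].
rewrite pairing_imset_of // !cardsU1 !inE (negPf neab) /= aC bC /=.
(* Moving the negative terms across leaves an equation between natural numbers. *)
rewrite -addrA -opprD -natrD -natrD; apply/eqP; rewrite subr_eq -natrD eqr_nat.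
by case: eqP; lia.
Qed.

End Pairing.

Arguments imset_of R {N} e C.

(** The paired relation involves only natural numbers, and their embedding in [R] is injective;
    [phi] stands for any of the three tests. *)
Lemma balance_of_relation (R : realType) (N : finType) (m a1 a2 : nat)
    (b : 'I_m -> nat) (e1 C1 e2 C2 : {set N}) (E D : 'I_m -> {set N})
    (f : {set N} -> R) (phi : {set N} -> {set N} -> bool) :
  (forall e C : {set N}, #|e| = 2%N -> [disjoint e & C] ->
     pairing f (imset_of R e C) = (phi e C)%:R) ->
  #|e1| = 2%N -> [disjoint e1 & C1] -> #|e2| = 2%N -> [disjoint e2 & C2] ->
  (forall i, #|E i| = 2%N /\ [disjoint E i & D i]) ->
  imset_of R e1 C1 *+ a1 + imset_of R e2 C2 *+ a2
    = \sum_(i < m) imset_of R (E i) (D i) *+ b i ->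
  (a1 * phi e1 C1 + a2 * phi e2 C2 = \sum_(i < m) b i * phi (E i) (D i))%N.
Proof.
move=> fP card1 dis1 card2 dis2 ED /(congr1 (pairing f)).
rewrite raddfD raddf_sum !raddfMn /= !fP // => rel.
apply/eqP; rewrite -(eqr_nat R) natrD natr_sum !natrM !mulr_natl rel.
apply/eqP/eq_bigr => i _; have [cardE disE] := ED i.
by rewrite raddfMn /= fP // natrM mulr_natl.
Qed.

(** * Assembly of the theorem *)

Lemma perm_eq_map_two (T : eqType) (m : nat) (v : 'I_m -> T) (i j : 'I_m) :
  i != j -> (forall k, k = i \/ k = j) ->
  m = 2%N /\ perm_eq [seq v k | k <- enum 'I_m] [:: v i; v j].
Proof.
move=> neij allij.
have ij : perm_eq (enum 'I_m) [:: i; j].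
  apply: uniq_perm; rewrite ?enum_uniq //= ?inE ?neij // => k.
  by rewrite mem_enum !inE; case: (allij k) => ->; rewrite eqxx ?orbT.
split; first by rewrite -(size_enum_ord m) (perm_size ij).
exact: (perm_map v ij).
Qed.

(** The theorem for terms already written as pairs and bases, with the left-hand terms ordered by
    base size. *)
Lemma square_of_card_le (R : realType) (N : finType) (m : nat)
    (e1 C1 e2 C2 : {set N}) (v : 'I_m -> {ffun {set N} -> R})
    (E D : 'I_m -> {set N}) (a1 a2 : nat) (b : 'I_m -> nat) :
  #|e1| = 2%N -> [disjoint e1 & C1] -> #|e2| = 2%N -> [disjoint e2 & C2] ->
  (forall i, [/\ #|E i| = 2%N, [disjoint E i & D i]
             & v i = imset_of R (E i) (D i)]) ->
  uniq [:: imset_of R e1 C1, imset_of R e2 C2 & [seq v i | i <- enum 'I_m]] ->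
  (0 < a1)%N -> (0 < a2)%N -> (forall i, 0 < b i)%N ->
  imset_of R e1 C1 *+ a1 + imset_of R e2 C2 *+ a2 = \sum_(i < m) v i *+ b i ->
  (0 < m)%N ->
  (#|C1| <= #|C2|)%N ->
  [/\ m = 2%N, a1 = a2, (forall i, b i = a1)
    & exists (a b1 b2 : N) (C : {set N}),
        [/\ uniq [:: a; b1; b2],
            [/\ a \notin C, b1 \notin C & b2 \notin C],
            perm_eq [:: imset_of R e1 C1; imset_of R e2 C2]
                    [:: eimset a b1 C; eimset a b2 (b1 |: C)]
          & perm_eq [seq v i | i <- enum 'I_m]
                    [:: eimset a b2 C; eimset a b1 (b2 |: C)]]].
Proof.
move=> card1 dis1 card2 dis2 EDP uv a1_gt0 a2_gt0 b_gt0 rel m_gt0 leC.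
have ED i : #|E i| = 2%N /\ [disjoint E i & D i] by case: (EDP i).
have cardE i : #|E i| = 2%N by case: (ED i).
have disE i : [disjoint E i & D i] by case: (ED i).
have vE i : v i = imset_of R (E i) (D i) by case: (EDP i).
have v_in i : v i \in [seq v j | j <- enum 'I_m] by rewrite map_f ?mem_enum.
move: uv => /= /and3P[]; rewrite inE negb_or => /andP[_ u1v] u2v v_uniq.
have ne1 i : E i = e1 -> D i <> C1.
  by move=> eE eD; move: u1v; rewrite -eE -eD -vE v_in.
have ne2 i : E i = e2 -> D i <> C2.
  by move=> eE eD; move: u2v; rewrite -eE -eD -vE v_in.
have v_inj i j : E i = E j -> D i = D j -> i = j.
  by move=> eE eD; apply: (injectiveP v v_uniq); rewrite !vE eE eD.
have relED : imset_of R e1 C1 *+ a1 + imset_of R e2 C2 *+ a2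
    = \sum_(i < m) imset_of R (E i) (D i) *+ b i.
  by rewrite rel; apply: eq_bigr => i _; rewrite vE.
have bal f phi := @balance_of_relation R N m a1 a2 b e1 C1 e2 C2 E D f phi.
have supset_bal T := bal _ _ (@pairing_supset R N T)
  card1 dis1 card2 dis2 ED relED.
have subset_bal T := bal _ _ (@pairing_subset R N T)
  card1 dis1 card2 dis2 ED relED.
have card_bal k := bal _ _ (@pairing_card R N k)
  card1 dis1 card2 dis2 ED relED.
have ltC : (#|C1| < #|C2|)%N.
  rewrite ltn_neqAle leC andbT; apply/eqP.
  (* Positivity of [m] provides the right-hand term on which equal sizes lead to a contradiction. *)
  exact: (balance_card_neq a1_gt0 a2_gt0 b_gt0 card1 card2 cardE
    dis1 dis2 disE ne1 ne2 supset_bal subset_bal card_bal (Ordinal m_gt0)).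
have [y [z [x [i1 [i2 [[e1E e2E C2E] [un zC yC xC] [E1 D1 E2 D2]]]]]]] :=
  balance_square a1_gt0 a2_gt0 b_gt0 card1 card2 cardE
    dis1 dis2 disE ne1 ne2 supset_bal subset_bal card_bal
    ltC v_inj.
move=> [ni all12] [a12 b1 b2].
have [m2 vP] := perm_eq_map_two v ni all12.
have [zy zx] : z != y /\ z != x.
  by move: un; rewrite /= !inE negb_or => /andP[/andP[]].
split=> // [i|]; first by case: (all12 i) => ->.
exists z, y, x, C1; split=> //.
  by rewrite !eimsetE // -e1E -e2E -C2E.
by rewrite (perm_trans vP) // !vE E1 D1 E2 D2 !eimsetE // -e1E -e2E.
Qed.

Theorem theorem6p2 (R : realType) (N : finType) (m : nat)
    (u1 u2 : {ffun {set N} -> R}) (v : 'I_m -> {ffun {set N} -> R})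
    (alpha1 alpha2 : nat) (beta : 'I_m -> nat) :
  (1 <= m)%N ->
  is_elementary_imset u1 ->
  is_elementary_imset u2 ->
  (forall i, is_elementary_imset (v i)) ->
  uniq [:: u1, u2 & [seq v i | i <- enum 'I_m]] ->
  (0 < alpha1)%N ->
  (0 < alpha2)%N ->
  (forall i, 0 < beta i)%N ->
  u1 *+ alpha1 + u2 *+ alpha2 = \sum_(i < m) v i *+ beta i ->
  [/\ m = 2%N,
      alpha1 = alpha2,
      (forall i, beta i = alpha1)
    & exists (a b1 b2 : N) (C : {set N}),
        [/\ uniq [:: a; b1; b2],
            [/\ a \notin C, b1 \notin C & b2 \notin C],
            perm_eq [:: u1; u2]
                    [:: eimset a b1 C; eimset a b2 (b1 |: C)]
          & perm_eq [seq v i | i <- enum 'I_m]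
                    [:: eimset a b2 C; eimset a b1 (b2 |: C)]]].
Proof.
move=> m_gt0 /elementary_imsetP[[e1 C1] [/= card1 dis1 ->]].
move=> /elementary_imsetP[[e2 C2] [/= card2 dis2 ->]] v_elem uv.
move=> a1_gt0 a2_gt0 b_gt0 rel.
(* Finite choice fixes a pair and a base for every right-hand term at once. *)
have [ED EDP] := fin_all_exists (fun i => elementary_imsetP (v_elem i)).
have [leC|/ltnW geC] := leqP #|C1| #|C2|.
- exact: (square_of_card_le (E := fst \o ED) (D := snd \o ED)) leC.
(* In the opposite order of sizes the two left-hand terms exchange roles. *)
- have [] := square_of_card_le (a1 := alpha2) (a2 := alpha1)
      (E := fst \o ED) (D := snd \o ED) card2 dis2 card1 dis1 EDP
      _ a2_gt0 a1_gt0 b_gt0 _ m_gt0 geC.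
  + by rewrite (perm_uniq (permEl (perm_catCA [:: _] [:: _] _))).
  + by rewrite addrC.
  move=> m2 a12 ba [a [b1 [b2 [C [un notC up vp]]]]].
  split=> // [i|]; first by rewrite ba.
  exists a, b1, b2, C; split=> //; apply: perm_trans up.
  by rewrite (permEl (perm_catC [:: _] [:: _])).
Qed.
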